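(* Let $n\ge1$. The restriction of $\Omega$ to the Edelman-Greene BPDs of size $n$ defines a bijection onto $\mathsf{RWT}(n-1)$. This bijection is shape preserving, and for each $w\in S_n$ it takes Edelman-Greene BPDs for $w$ (those lying in $\mathsf{Pipes}(w)$) to reduced word tableaux for $w$ (those whose column reading word is a reduced word for $w$).
   Context: Bumpless pipe dreams. Cells $(i,j)$ of the $n\times n$ grid: row $i$ from the top, column $j$ from the left. There are six tiles: downward elbow (a pipe joining the bottom and right edges), upward elbow (a pipe joining the left and top edges), crossing (one pipe joining left and right edges and one joining bottom and top edges), blank (no pipe), horizontal (left to right), vertical (bottom to top). A bumpless pipe dream (BPD) of size $n$ is a tiling of the grid by these tiles such that an edge shared by two cells is met by a pipe from both sides or from neither, every bottom and right boundary edge is met by a pipe, and no left or top boundary edge is met by a pipe. So there are $n$ pipes, running from the bottom boundary to the right boundary. A BPD is reduced if every pair of pipes crosses at most once. $D(\mathcal P)$ is the set of positions of blank tiles. Demazure product $\partial(\mathcal P)\in S_n$: label the bottom boundary edges $1,\dots,n$ from left to right and propagate labels along pipes north and east; at a crossing tile, of the two labels entering from the left and from below, the smaller leaves through the right edge and the larger through the top edge. $\partial(\mathcal P)(i)$ is the label arriving at the right boundary edge of row $i$. $\mathsf{Pipes}(w)=\{\mathcal P:\partial(\mathcal P)=w\}$. For a partition $\lambda$, $\mathbb Y(\lambda)=\{(i,j):1\le j\le\lambda_i\}$. A BPD $\mathcal P$ is Hecke, of shape $\lambda$, if $D(\mathcal P)=\mathbb Y(\lambda)$ for some partition $\lambda$.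 An Edelman-Greene BPD is a Hecke BPD that is reduced. A decreasing tableau of shape $\lambda$ is a function $\mathbb Y(\lambda)\to\{1,2,\dots\}$ whose values strictly decrease along rows (left to right) and down columns. The column reading word reads entries along columns from bottom to top, columns taken from left to right. A word $(a_1,\dots,a_k)$ is a reduced word for $w$ if $w=s_{a_1}\cdots s_{a_k}$ with $s_i=(i\ i+1)$ and $k=\ell(w)$. $\mathsf{RWT}(n-1)$ is the set of reduced word tableaux: decreasing tableaux with entries in $\{1,\dots,n-1\}$ whose column reading word is reduced (a reduced word of the permutation it represents). The map $\Omega$: in each diagonal $\{(i,j):j-i=c\}$ of a BPD there are as many blank tiles as crossing tiles. Ordering each diagonal from northwest to southeast, pair the first blank tile with the last crossing tile, the second blank tile with the second-to-last crossing tile, and so on. For a Hecke BPD $\mathcal P$, $\Omega(\mathcal P)$ is the filling of $D(\mathcal P)$ in which a blank cell in row $i$ whose paired crossing tile is in row $i'$ receives the value $i'-i$. *)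

(* Defs.v *)
From HB Require Import structures.
From mathcomp Require Import all_boot all_order all_algebra all_fingroup.
From mathcomp Require Import finmap.
From mathcomp Require Import boolp classical_sets functions.

Set Implicit Arguments.
Unset Strict Implicit.
Unset Printing Implicit Defensive.

Local Open Scope fset_scope.
Local Open Scope fmap_scope.
Local Open Scope classical_set_scope.
Local Open Scope nat_scope.

(* Rows, columns, pipe labels and the letters permuted by 'S_n
   are numbered from 0; the entries of words and tableaux keep their usual
   values 1, 2, ... *)

(* DownElbow joins bottom and right, UpElbow joins left and top. *)
Variant tile := DownElbow | UpElbow | Crossing | Blank | Horizontal | Vertical.

Lemma tile_comparable : comparable tile.
Proof. by move=> s t; rewrite /decidable; decide equality. Qed.

HB.instance Definition _ := hasDecEq.Build tile (compareP tile_comparable).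

Definition meets_left (t : tile) : bool :=
  match t with UpElbow | Crossing | Horizontal => true | _ => false end.
Definition meets_right (t : tile) : bool :=
  match t with DownElbow | Crossing | Horizontal => true | _ => false end.
Definition meets_top (t : tile) : bool :=
  match t with UpElbow | Crossing | Vertical => true | _ => false end.
Definition meets_bottom (t : tile) : bool :=
  match t with DownElbow | Crossing | Vertical => true | _ => false end.

Record is_bpd (n : nat) (P : 'M[tile]_n) : Prop := IsBpd {
  bpd_horizontal_edge : forall i j j' : 'I_n, j' = j.+1 :> nat ->
    meets_right (P i j) = meets_left (P i j');
  bpd_vertical_edge : forall i i' j : 'I_n, i' = i.+1 :> nat ->
    meets_bottom (P i j) = meets_top (P i' j);
  bpd_bottom_boundary : forall i j : 'I_n, i.+1 = n -> meets_bottom (P i j);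
  bpd_right_boundary : forall i j : 'I_n, j.+1 = n -> meets_right (P i j);
  bpd_top_boundary : forall i j : 'I_n, i = 0 :> nat -> ~~ meets_top (P i j);
  bpd_left_boundary : forall i j : 'I_n, j = 0 :> nat -> ~~ meets_left (P i j)
}.

(* Labels travel north and east; None marks an edge that no pipe meets.  The
   parameter rule says what a crossing does: from the labels entering at the
   left and at the bottom, it gives those leaving at the right and at the top. *)
Section Labels.
Variable n : nat.
Implicit Type P : 'M[tile]_n.

Definition label := option 'I_n.
Definition crossing_rule := label -> label -> label * label.

Definition straight : crossing_rule := fun a b => (a, b).

Definition demazure_rule : crossing_rule := fun a b =>
  match a, b with
  | Some x, Some y => if x <= y then (a, b) else (b, a)
  | _, _ => (a, b)
  end.

Definition route (rule : crossing_rule) (t : tile) (a b : label) :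
    label * label :=
  match t with
  | DownElbow => (b, None)
  | UpElbow => (None, a)
  | Crossing => rule a b
  | Blank => (None, None)
  | Horizontal => (a, None)
  | Vertical => (None, b)
  end.

Definition tile_at P (i j : nat) : tile :=
  match insub i, insub j with
  | Some a, Some b => P a b
  | _, _ => Blank
  end.

(* The label on the left edge of column j in a row with tiles t, where v gives
   the labels on the bottom edges of that row.  At j = n this is the right
   boundary edge. *)
Fixpoint row_label (rule : crossing_rule) (t : nat -> tile) (v : nat -> label)
    (j : nat) : label :=
  if j is j'.+1 then (route rule (t j') (row_label rule t v j') (v j')).1
  else None.

(* The label in column j on the horizontal grid line at height k, with k = 0
   the bottom boundary. *)
Fixpoint line_label (rule : crossing_rule) P (k j : nat) : label :=
  if k is k'.+1 then
    let t := tile_at P (n - k'.+1) in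
    let v := line_label rule P k' in
    (route rule (t j) (row_label rule t v j) (v j)).2
  else insub j.

Definition label_below rule P (i j : nat) : label :=
  line_label rule P (n - i.+1) j.

Definition label_left rule P (i j : nat) : label :=
  row_label rule (tile_at P i) (label_below rule P i) j.

Definition demazure_product P (i : 'I_n) : label :=
  label_left demazure_rule P i n.

Definition Pipes (w : 'S_n) : set 'M[tile]_n :=
  [set P | is_bpd P /\ forall i, demazure_product P i = Some (w i)].

(* With the straight rule, the label p marks exactly the edges of the pipe that
   starts at the bottom of column p. *)
Definition pipes_cross_at P (p q : 'I_n) (c : 'I_n * 'I_n) : bool :=
  let a := label_left straight P c.1 c.2 in
  let b := label_below straight P c.1 c.2 in
  (P c.1 c.2 == Crossing) &&
  (((a == Some p) && (b == Some q)) || ((a == Some q) && (b == Some p))).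

Definition bpd_reduced P : Prop :=
  forall p q : 'I_n, p != q -> #|[pred c | pipes_cross_at P p q c]| <= 1.

End Labels.

Definition is_part (la : seq nat) : bool := sorted geq la.

Definition young (la : seq nat) : {fset nat * nat} :=
  [fset c in [seq (i, j) | i <- iota 0 (size la), j <- iota 0 (nth 0 la i)]].

Lemma mem_young (la : seq nat) (i j : nat) :
  ((i, j) \in young la) = (j < nth 0 la i).
Proof.
rewrite !inE /=; apply/allpairsPdep/idP => [[x [y [_ yP [-> ->]]]]|ltj].
  by move: yP; rewrite mem_iota.
exists i, j; rewrite !mem_iota /= !add0n ltj; split=> //.
by case: ltnP => // le; rewrite nth_default in ltj.
Qed.

Definition blanks (n : nat) (P : 'M[tile]_n) : {fset nat * nat} :=
  [fset c in [seq (d.1 : nat, d.2 : nat) |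
              d : 'I_n * 'I_n <- enum {: 'I_n * 'I_n} & P d.1 d.2 == Blank]].

Definition hecke_of_shape (n : nat) (la : seq nat) (P : 'M[tile]_n) : Prop :=
  [/\ is_bpd P, is_part la & blanks P = young la].

Definition hecke (n : nat) (P : 'M[tile]_n) : Prop :=
  exists la, hecke_of_shape la P.

Definition edelman_greene (n : nat) : set 'M[tile]_n :=
  [set P | hecke P /\ bpd_reduced P].

(* A filling is a finite partial function; its domain is the set of its cells. *)
Definition filling := {fmap (nat * nat) -> nat}.

Definition entry (T : filling) (c : nat * nat) : nat := odflt 0 T.[? c].

Definition decreasing_tableau (la : seq nat) (T : filling) : Prop :=
  [/\ is_part la,
      domf T = young la,
      forall c : nat * nat, c \in domf T -> 0 < entry T c,
      forall i j j' : nat, (i, j) \in domf T -> (i, j') \in domf T ->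
        j < j' -> entry T (i, j') < entry T (i, j)
    & forall i i' j : nat, (i, j) \in domf T -> (i', j) \in domf T ->
        i < i' -> entry T (i', j) < entry T (i, j)].

Definition column_order (c d : nat * nat) : bool :=
  (c.2 < d.2) || ((c.2 == d.2) && (d.1 <= c.1)).

Definition column_word (T : filling) : seq nat :=
  [seq entry T c | c <- sort column_order (enum_fset (domf T))].

(* The transposition (k k+1) of 1, ..., n, hence of k-1 and k here; it is only
   meant for 0 < k < n. *)
Definition simple_transposition (n k : nat) : 'S_n :=
  match insub k.-1, insub k with
  | Some x, Some y => tperm x y
  | _, _ => 1%g
  end.

(* The product s_{a_1} ... s_{a_k} of permutations composed from right to left.
   MathComp composes from left to right, (s * t) x = t (s x), hence the rev. *)
Definition word_perm (n : nat) (a : seq nat) : 'S_n :=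
  (\prod_(k <- rev a) simple_transposition n k)%g.

Definition inversions (n : nat) (w : 'S_n) : nat :=
  #|[pred p : 'I_n * 'I_n | (p.1 < p.2) && (w p.2 < w p.1)]|.

Definition reduced_word (n : nat) (w : 'S_n) (a : seq nat) : Prop :=
  [/\ all (fun k => 0 < k < n) a, w = word_perm n a & size a = inversions w].

Definition RWT (m : nat) : set filling :=
  [set T | [/\ exists la, decreasing_tableau la T,
               forall c : nat * nat, c \in domf T -> 1 <= entry T c <= m
             & exists w : 'S_m.+1, reduced_word w (column_word T)]].

(* The rows, from northwest to southeast, of the tiles t on the diagonal
   through (i, j). *)
Definition diagonal_rows (n : nat) (P : 'M[tile]_n) (t : tile) (i j : nat) :
    seq nat :=
  [seq (a : nat) | a : 'I_n <- enum 'I_n &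
     [exists b : 'I_n, (b + i == a + j) && (P a b == t)]].

Definition paired_crossing_row (n : nat) (P : 'M[tile]_n) (i j : nat) : nat :=
  nth 0 (rev (diagonal_rows P Crossing i j))
    (index i (diagonal_rows P Blank i j)).

(* The subtraction is truncated, but in a Hecke BPD the crossings of a diagonal
   lie southeast of its blanks. *)
Definition Omega (n : nat) (P : 'M[tile]_n) : filling :=
  [fmap c : blanks P =>
     paired_crossing_row P (val c).1 (val c).2 - (val c).1].

(* Main.v *)
Require Import Defs.
From mathcomp Require Import all_boot all_order all_algebra all_fingroup.
From mathcomp Require Import finmap zify.
From mathcomp Require Import boolp classical_sets functions.

Set Implicit Arguments.
Unset Strict Implicit.
Unset Printing Implicit Defensive.

Local Open Scope fset_scope.
Local Open Scope fmap_scope.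
Local Open Scope nat_scope.

(* Let R(i, j) be the number of pipes that cross the horizontal line at depth i
   in the columns left of j.  Neighbouring values of R differ by 0 or 1, R
   determines the BPD, and along a diagonal R grows by 0 at a blank, by 2 at a
   crossing and by 1 at any other tile.  Hence for a Hecke BPD the filling
   T = Omega(P) is dual to R: for t >= 1, t <= T(a, b) if and only if
   R(a + t, b + t) < t.  This duality turns the conditions on height functions
   into those on decreasing tableaux, and back.

   Read P as a wiring diagram, row by row from the bottom, each row from left to
   right.  A crossing at (i, j) acts on the strands in positions R(i, j) and
   R(i, j) + 1 (from 0), and the crossing paired with (a, b) is at
   (a + T, b + T) with R = T - 1, so it is the simple transposition s_T.  The
   word of the crossings therefore has the letters of the column reading word,
   and two letters that differ by one come in the same order in both, so that
   the words represent the same permutation.  Finally the inversions of that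
   permutation are the pairs of pipes that cross an odd number of times: the
   word is reduced if and only if no pair crosses twice, and in that case the
   Demazure rule never departs from following the pipes. *)

(** * Height functions *)

(** The bottom edge follows from the other three by conservation. The wildcards absorb the two edge
    triples that no tile has. *)
Definition tile_of_edges (l t r : bool) : tile :=
  match l, t, r with
  | true, true, true => Crossing
  | true, true, false => UpElbow
  | true, false, _ => Horizontal
  | false, true, _ => Vertical
  | false, false, true => DownElbow
  | false, false, false => Blank
  end.

Lemma tile_of_edgesK (t : tile) :
  tile_of_edges (meets_left t) (meets_top t) (meets_right t) = t.
Proof. by case: t. Qed.

Lemma tile_conservation (t : tile) :
  meets_left t + meets_bottom t = meets_top t + meets_right t.
Proof. by case: t. Qed.

Lemma tile_weight (t : tile) :
  meets_top t + meets_right t = (t != Blank) + (t == Crossing).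
Proof. by case: t; do 2!case: eqP. Qed.

Lemma ord_cases (n i : nat) : i < n -> exists a : 'I_n, i = a.
Proof. by move=> lt_in; exists (Ordinal lt_in). Qed.

Section Height.
Variables (n : nat) (P : 'M[tile]_n).

Lemma tile_at_ord (a b : 'I_n) : tile_at P a b = P a b.
Proof. by rewrite /tile_at !valK. Qed.

(** The value [true] beyond the grid stands for the pipes that meet the bottom boundary; [left_edge]
    treats the right boundary in the same way. *)
Definition top_edge (i j : nat) : bool :=
  if i < n then meets_top (tile_at P i j) else true.

Definition left_edge (i j : nat) : bool :=
  if j < n then meets_left (tile_at P i j) else true.

(** For a BPD this is the corner sum of the alternating sign matrix with 1 at downward elbows and -1
    at upward elbows. *)
Definition height (i j : nat) : nat := \sum_(0 <= k < j) top_edge i k.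

Lemma heightS (i j : nat) : height i j.+1 = height i j + top_edge i j.
Proof. by rewrite /height big_nat_recr. Qed.

Lemma height_le (i j k : nat) : j <= k -> height i j <= height i k.
Proof.
move=> /subnK <-; elim: (k - j) => // d IH.
by rewrite addSn heightS (leq_trans IH) ?leq_addr.
Qed.

Lemma height_i0 (i : nat) : height i 0 = 0.
Proof. by rewrite /height big_geq. Qed.

Hypothesis bpdP : is_bpd P.

Lemma right_left_edge (i j : nat) : i < n -> j < n ->
  meets_right (tile_at P i j) = left_edge i j.+1.
Proof.
move=> /ord_cases[a ->] /ord_cases[b ->]; rewrite /left_edge.
case: ltnP => lt_b.
  have /ord_cases[b' eq_b] := lt_b.
  by rewrite eq_b !tile_at_ord (bpd_horizontal_edge bpdP a (esym eq_b)).
rewrite tile_at_ord; apply: (bpd_right_boundary bpdP).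
by apply/eqP; rewrite eqn_leq lt_b ltn_ord.
Qed.

Lemma bottom_top_edge (i j : nat) : i < n -> j < n ->
  meets_bottom (tile_at P i j) = top_edge i.+1 j.
Proof.
move=> /ord_cases[a ->] /ord_cases[b ->]; rewrite /top_edge.
case: ltnP => lt_a.
  have /ord_cases[a' eq_a] := lt_a.
  by rewrite eq_a !tile_at_ord (bpd_vertical_edge bpdP b (esym eq_a)).
rewrite tile_at_ord; apply: (bpd_bottom_boundary bpdP).
by apply/eqP; rewrite eqn_leq lt_a ltn_ord.
Qed.

Lemma left_edge0 (i : nat) : i < n -> left_edge i 0 = false.
Proof.
move=> /ord_cases[a ->]; rewrite /left_edge.
have n_gt0 : 0 < n by apply: leq_ltn_trans (ltn_ord a).
rewrite n_gt0 -[0]/(nat_of_ord (Ordinal n_gt0)) tile_at_ord.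
by apply/negbTE/(bpd_left_boundary bpdP).
Qed.

Lemma top_edge0 (j : nat) : j < n -> top_edge 0 j = false.
Proof.
move=> /ord_cases[b ->]; rewrite /top_edge.
have n_gt0 : 0 < n by apply: leq_ltn_trans (ltn_ord b).
rewrite n_gt0 -[0]/(nat_of_ord (Ordinal n_gt0)) tile_at_ord.
by apply/negbTE/(bpd_top_boundary bpdP).
Qed.

Lemma edge_conservation (i j : nat) : i < n -> j < n ->
  left_edge i j + top_edge i.+1 j = top_edge i j + left_edge i j.+1.
Proof.
move=> lti ltj; rewrite -right_left_edge // -bottom_top_edge //.
by rewrite /left_edge /top_edge lti ltj tile_conservation.
Qed.

(** Conservation summed over the cells of row [i] left of column [j]: pipes enter this strip from
    below only, none at the left boundary, and leave it through its top or through the left edge of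
    column [j]. *)
Lemma height_Sl (i j : nat) : i < n -> j <= n ->
  height i.+1 j = height i j + left_edge i j.
Proof.
move=> lti; elim: j => [|j IH] ltj; first by rewrite !height_i0 left_edge0.
by rewrite !heightS IH 1?ltnW // -addnA edge_conservation // addnA.
Qed.

Lemma height_lel (i i' j : nat) : i <= i' -> i' <= n -> j <= n ->
  height i j <= height i' j.
Proof.
move=> /subnK <-; elim: (i' - i) => // d IH ltn lej.
rewrite addSn height_Sl //; apply: leq_trans (leq_addr _ _).
by apply: IH => //; apply: ltnW.
Qed.

Lemma height_0j (j : nat) : j <= n -> height 0 j = 0.
Proof.
by elim: j => [|j IH] lej; rewrite ?height_i0 // heightS IH 1?ltnW // top_edge0.
Qed.

Lemma height_nj (j : nat) : height n j = j.
Proof.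
by elim: j => [|j IH]; rewrite ?height_i0 // heightS IH /top_edge ltnn addn1.
Qed.

Lemma height_in (i : nat) : i <= n -> height i n = i.
Proof.
elim: i => [|i IH] lei; first exact: height_0j.
by rewrite height_Sl // IH 1?ltnW // /left_edge ltnn addn1.
Qed.

Lemma height_minl (i j : nat) : i <= n -> j <= n -> height i j <= i.
Proof. by move=> lei lej; rewrite -{2}(height_in lei) height_le. Qed.

Lemma height_minr (i j : nat) : i <= n -> j <= n -> height i j <= j.
Proof. by move=> lei lej; rewrite -{2}(height_nj j) height_lel. Qed.

(** The diagonal step passes the top and the right edge of the tile, and each pipe in the tile
    leaves through exactly one of these. *)
Lemma height_diag (i j : nat) : i < n -> j < n ->
  height i.+1 j.+1 = height i j + (tile_at P i j != Blank)
                     + (tile_at P i j == Crossing).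
Proof.
move=> lti ltj; rewrite height_Sl // heightS -right_left_edge //.
by rewrite /top_edge lti -!addnA tile_weight.
Qed.

Lemma tile_at_height (i j : nat) : i < n -> j < n ->
  tile_at P i j = tile_of_edges (height i.+1 j != height i j)
    (height i j.+1 != height i j) (height i.+1 j.+1 != height i j.+1).
Proof.
move=> lti ltj; rewrite -{1}[tile_at P i j]tile_of_edgesK.
have neq (m : nat) (b : bool) : (m + b != m) = b.
  by case: b; rewrite ?addn0 ?addn1 ?eqxx // neq_ltn ltnSn orbT.
congr tile_of_edges.
- by rewrite (height_Sl lti (ltnW ltj)) neq /left_edge ltj.
- by rewrite heightS neq /top_edge lti.
- by rewrite height_Sl // neq right_left_edge.
Qed.

End Height.

Lemma height_inj (n : nat) (P Q : 'M[tile]_n) : is_bpd P -> is_bpd Q ->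
  (forall i j, i <= n -> j <= n -> height P i j = height Q i j) -> P = Q.
Proof.
move=> bP bQ eqh; apply/matrixP => i j.
by rewrite -!tile_at_ord !tile_at_height // !eqh // ltnW.
Qed.

(** These are the corner sum matrices of alternating sign matrices; each of them is shown below to
    be the height of a BPD. *)
Record height_function (n : nat) (R : nat -> nat -> nat) : Prop :=
  HeightFunction {
  hf_top : forall j, j <= n -> R 0 j = 0;
  hf_left : forall i, i <= n -> R i 0 = 0;
  hf_bottom : forall j, j <= n -> R n j = j;
  hf_right : forall i, i <= n -> R i n = i;
  hf_row : forall i j, i <= n -> j < n -> R i j <= R i j.+1 <= (R i j).+1;
  hf_col : forall i j, i < n -> j <= n -> R i j <= R i.+1 j <= (R i j).+1 }.

Definition bpd_of_height (n : nat) (R : nat -> nat -> nat) : 'M[tile]_n :=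
  \matrix_(i, j) tile_of_edges (R i.+1 j != R i j) (R i j.+1 != R i j)
    (R i.+1 j.+1 != R i j.+1).

Section OfHeight.
Variables (n : nat) (R : nat -> nat -> nat).
Hypothesis hfR : height_function n R.
Let P := bpd_of_height n R.

(** Both ways around a cell have the same total and all steps are 0 or 1. Hence the edge triples
    that no tile has do not occur, and the bottom edge comes out right. *)
Lemma bpd_of_height_edges (i j : 'I_n) :
  [/\ meets_left (P i j) = (R i.+1 j != R i j),
      meets_top (P i j) = (R i j.+1 != R i j),
      meets_right (P i j) = (R i.+1 j.+1 != R i j.+1)
    & meets_bottom (P i j) = (R i.+1 j.+1 != R i.+1 j)].
Proof.
have lti := ltn_ord i; have ltj := ltn_ord j.
have := hf_row hfR (ltnW lti) ltj; have := hf_row hfR lti ltj.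
have := hf_col hfR lti (ltnW ltj); have := hf_col hfR lti ltj.
rewrite mxE; set a := R i j; set b := R _.+1 j; set c := R i _.+1.
set d := R _.+1 _.+1 => h1 h2 h3 h4.
by case: eqP => e1; case: eqP => e2; case: eqP => e3; split=> //=; lia.
Qed.

Lemma bpd_of_height_bpd : is_bpd P.
Proof.
split.
- move=> i j j' eqj; have [_ _ -> _] := bpd_of_height_edges i j.
  by have [-> _ _ _] := bpd_of_height_edges i j'; rewrite eqj.
- move=> i i' j eqi; have [_ _ _ ->] := bpd_of_height_edges i j.
  by have [_ -> _ _] := bpd_of_height_edges i' j; rewrite eqi.
- move=> i j eqi; have [_ _ _ ->] := bpd_of_height_edges i j.
  by rewrite eqi (hf_bottom hfR (ltn_ord j)) (hf_bottom hfR (ltnW (ltn_ord j)))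
    neq_ltn ltnSn orbT.
- move=> i j eqj; have [_ _ -> _] := bpd_of_height_edges i j.
  by rewrite eqj (hf_right hfR (ltn_ord i)) (hf_right hfR (ltnW (ltn_ord i)))
    neq_ltn ltnSn orbT.
- move=> i j eqi; have [_ -> _ _] := bpd_of_height_edges i j.
  by rewrite eqi (hf_top hfR (ltn_ord j)) (hf_top hfR (ltnW (ltn_ord j))) eqxx.
- move=> i j eqj; have [-> _ _ _] := bpd_of_height_edges i j.
  by rewrite eqj (hf_left hfR (ltn_ord i)) (hf_left hfR (ltnW (ltn_ord i)))
    eqxx.
Qed.

Lemma height_bpd_of_height (i j : nat) : i <= n -> j <= n ->
  height P i j = R i j.
Proof.
rewrite leq_eqVlt => /predU1P[-> lej|lti].
  by rewrite height_nj (hf_bottom hfR).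
elim: j => [|j IH] lej; first by rewrite height_i0 (hf_left hfR) // ltnW.
rewrite heightS IH 1?ltnW // /top_edge lti.
have := hf_row hfR (ltnW lti) lej.
move: lti lej => /ord_cases[a ->] /ord_cases[b ->]; rewrite tile_at_ord.
have [_ -> _ _] := bpd_of_height_edges a b.
by case: eqP => /=; lia.
Qed.

End OfHeight.

(** * The duality between heights and entries *)

Lemma young_down (la : seq nat) (i j i' j' : nat) : is_part la ->
  i' <= i -> j' <= j -> (i, j) \in young la -> (i', j') \in young la.
Proof.
rewrite !mem_young => la_part lei lej ltj; apply: leq_ltn_trans lej _.
apply: leq_trans ltj _; have [lti|gei] := ltnP i (size la); last first.
  by rewrite nth_default.
have geq_trans : transitive geq.
  by move=> x y z /= xy zx; apply: leq_trans zx xy.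
by apply: (sorted_leq_nth geq_trans _ 0 la_part);
  rewrite ?inE // ?(leq_ltn_trans lei) //; exact: leqnn.
Qed.

Lemma filter_iota_split (p : pred nat) (n x : nat) : p x -> x < n ->
  [seq y <- iota 0 n | p y] =
    [seq y <- iota 0 x | p y] ++ x :: [seq y <- iota x.+1 (n - x.+1) | p y].
Proof.
move=> px ltx; have {1}-> : n = x + (n - x.+1).+1 by lia.
by rewrite iotaD filter_cat /= px.
Qed.

Lemma index_filter_iota (p : pred nat) (n x : nat) : p x -> x < n ->
  index x [seq y <- iota 0 n | p y] = count p (iota 0 x).
Proof.
move=> px ltx; rewrite (filter_iota_split px ltx) index_cat.
by rewrite mem_filter mem_iota add0n ltnn !andbF /= eqxx addn0 size_filter.
Qed.

(** In the reversed list the index of an element is the number of later ones; this is how the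
    pairing counts crossings from the southeast end. *)
Lemma nth_rev_filter_iota (q : pred nat) (n x : nat) : q x -> x < n ->
  nth 0 (rev [seq y <- iota 0 n | q y]) (count q (iota x.+1 (n - x.+1))) = x.
Proof.
move=> qx ltx; rewrite (filter_iota_split qx ltx) rev_cat rev_cons cat_rcons.
by rewrite nth_cat size_rev size_filter ltnn subnn.
Qed.

Lemma mem_blanks (n : nat) (P : 'M[tile]_n) (i j : nat) :
  ((i, j) \in blanks P) = [&& i < n, j < n & tile_at P i j == Blank].
Proof.
rewrite !inE /=; apply/mapP/and3P => [[[a b]]|].
  rewrite mem_filter /= => /andP[Pab _] [-> ->].
  by rewrite !ltn_ord tile_at_ord.
case=> /ord_cases[a ->] /ord_cases[b ->]; rewrite tile_at_ord => Pab.
by exists (a, b); rewrite // mem_filter mem_enum inE /= Pab.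
Qed.

Lemma diagonal_rowsE (n : nat) (P : 'M[tile]_n) (t : tile) (i j : nat) :
  diagonal_rows P t i j =
  [seq x <- iota 0 n |
    [&& i <= x + j, x + j - i < n & tile_at P x (x + j - i) == t]].
Proof.
rewrite /diagonal_rows -val_enum_ord filter_map; congr map.
apply: eq_filter => a /=; apply/existsP/and3P => [[b /andP[/eqP eqb Pab]]|].
  have -> : a + j - i = b by lia.
  by rewrite tile_at_ord ltn_ord; split=> //; lia.
case=> lei /ord_cases[b eqb]; rewrite eqb tile_at_ord => Pab.
by exists b; rewrite Pab andbT -eqb subnK.
Qed.

Lemma entry_Omega (n : nat) (P : 'M[tile]_n) (a b : nat) :
  entry (Omega P) (a, b) =
  if (a, b) \in blanks P then paired_crossing_row P a b - a else 0.
Proof.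
rewrite /entry; case: ifP => abP; last by rewrite not_fnd // abP.
by rewrite (in_fnd abP) ffunE.
Qed.

Section Hecke.
Variables (n : nat) (P : 'M[tile]_n).
Hypothesis heckeP : hecke P.

Let bpdP : is_bpd P. Proof. by case: heckeP => la []. Qed.

Lemma blanks_down (i j i' j' : nat) : i' <= i -> j' <= j ->
  (i, j) \in blanks P -> (i', j') \in blanks P.
Proof. by case: heckeP => la [_ la_part ->]; apply: young_down. Qed.

(** The cells to the left in the same row are blank as well, so no pipe meets their bottom edges. *)
Lemma height_blank (i j : nat) : (i, j) \in blanks P ->
  height P i.+1 j.+1 = 0.
Proof.
move=> ijP; rewrite /height big_nat big1 // => k /=; rewrite ltnS => lek.
have := blanks_down (leqnn i) lek ijP; rewrite mem_blanks => /and3P[lti ltk].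
by move=> /eqP Pik; rewrite -bottom_top_edge // Pik.
Qed.

(** A diagonal that has left the Young diagram never returns to it, and every tile that is not blank
    adds at least 1. *)
Lemma height_diag_ge (i j d : nat) : i + d <= n -> j + d <= n ->
  (i, j) \notin blanks P -> height P i j + d <= height P (i + d) (j + d).
Proof.
move=> + + ijP; elim: d => [|d IH] lei lej; first by rewrite !addn0.
have lti : i + d < n by rewrite -addnS.
have ltj : j + d < n by rewrite -addnS.
have : (i + d, j + d) \notin blanks P.
  by apply: contra ijP; apply: blanks_down; rewrite leq_addr.
rewrite mem_blanks lti ltj /= !addnS height_diag // => ->.
by have := IH (ltnW lti) (ltnW ltj); lia.
Qed.

(** Past the blanks every tile adds 1 to the height and every crossing one more, while the height at
    the end of the diagonal is known from the boundary. *)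
Lemma count_diagonal_crossings (a b u : nat) : a + u <= n -> b + u <= n ->
  (a + u, b + u) \notin blanks P ->
  count (fun x => [&& a <= x + b, x + b - a < n &
                      tile_at P x (x + b - a) == Crossing])
        (iota (a + u) (n - (a + u))) + height P (a + u) (b + u)
  = minn a b + u.
Proof.
set q := fun x => _; have [d] := ubnP (n - (a + u)); elim: d u => // d IH u.
move=> ltd lea leb nblank.
have [eqa|lta] := eqVneq (a + u) n.
  by rewrite eqa subnn /= height_nj; lia.
have [eqb|ltb] := eqVneq (b + u) n.
  (* The right boundary is reached, so the remaining rows have no cell on this diagonal. *)
  rewrite eqb height_in // (_ : count _ _ = 0); last first.
    apply/eqP; rewrite -leqn0 leqNgt -has_count; apply/hasPn => x.
    by rewrite mem_iota /q => /andP[lex _]; lia.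
  by lia.
have {}lta : a + u < n by lia.
have {}ltb : b + u < n by lia.
have tileN : tile_at P (a + u) (b + u) != Blank.
  by move: nblank; rewrite mem_blanks lta ltb.
have qE : q (a + u) = (tile_at P (a + u) (b + u) == Crossing).
  have sub : a + u + b - a = b + u by lia.
  by rewrite /q sub ltb -addnA leq_addr.
have nblank' : (a + u.+1, b + u.+1) \notin blanks P.
  by apply: contra nblank; apply: blanks_down; rewrite leq_add2l.
have := IH u.+1 _ _ _ nblank'; rewrite !addnS height_diag // tileN -qE.
have -> : n - (a + u) = (n - (a + u).+1).+1 by lia.
by rewrite /=; lia.
Qed.

End Hecke.

Section OmegaHecke.
Variables (n : nat) (P : 'M[tile]_n).
Hypothesis heckeP : hecke P.

Let bpdP : is_bpd P. Proof. by case: heckeP => la []. Qed.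

(** Let [t] be the last index with R(a + t, b + t) < t. The height must jump by 2 there, so the cell
    is a crossing. It is the one paired with [(a, b)] because as many crossings follow it on the
    diagonal as blanks precede [(a, b)]. *)
Lemma entry_Omega_blank (a b : nat) : (a, b) \in blanks P ->
  let t := entry (Omega P) (a, b) in
  [/\ 0 < t, a + t < n, b + t < n, tile_at P (a + t) (b + t) = Crossing
    & height P (a + t) (b + t) = t.-1 /\
      forall u, t < u -> a + u <= n -> b + u <= n ->
        u <= height P (a + u) (b + u)].
Proof.
move=> abP; have := abP; rewrite mem_blanks => /and3P[lta ltb _].
pose low u := [&& a + u <= n, b + u <= n & height P (a + u) (b + u) < u].
have low1 : low 1 by rewrite /low !addn1 lta ltb height_blank.
have low_le u : low u -> u <= n by case/and3P; lia.
case: (ex_maxnP (ex_intro _ 1 low1) low_le) => t /and3P[lea leb ltt] maxt.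
have t_gt0 : 0 < t := maxt _ low1.
(* On the boundary the height is [b + t] or [a + t], hence not below [t]; so the diagonal continues
   past [t]. *)
have {}lea : a + t < n.
  rewrite ltn_neqAle lea andbT; apply/eqP => eqa.
  by move: ltt; rewrite eqa height_nj; lia.
have {}leb : b + t < n.
  rewrite ltn_neqAle leb andbT; apply/eqP => eqb.
  by move: ltt; rewrite eqb (height_in bpdP (ltnW lea)); lia.
have high u : t < u -> a + u <= n -> b + u <= n ->
    u <= height P (a + u) (b + u).
  move=> ltu leau lebu; rewrite leqNgt; apply: contraL ltu => ltu.
  by rewrite -leqNgt maxt // /low leau lebu.
(* The height is at most [t.-1] here and at least [t.+1] one step further, while a tile adds at most
   2: both bounds are attained. *)
have [tileX htt] :
    tile_at P (a + t) (b + t) = Crossing /\ height P (a + t) (b + t) = t.-1.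
  have := high t.+1 (leqnn _); rewrite !addnS => /(_ lea leb).
  rewrite height_diag //; case: (_ != Blank); case: eqP => [->|_] h1;
    [split=> // | | split=> // | ]; lia.
have nblank : (a + t, b + t) \notin blanks P.
  rewrite mem_blanks lea leb tileX /=; by apply/eqP.
have nblankS : (a + t.+1, b + t.+1) \notin blanks P.
  by apply: contra nblank; apply: (blanks_down heckeP); rewrite leq_add2l.
suff -> : entry (Omega P) (a, b) = t by [].
rewrite entry_Omega abP /paired_crossing_row !diagonal_rowsE.
rewrite index_filter_iota //=; last first.
  by rewrite leq_addr addKn ltb; move: abP; rewrite mem_blanks lta ltb.
(* Every cell of the diagonal northwest of [(a, b)] is blank, and there are [minn a b] of them; the
   rows before [a - b] have no cell on it. *)
set k := count _ _; have -> : k = minn a b.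
  have iota_split := iotaD 0 (a - b) (minn a b).
  rewrite add0n (_ : a - b + minn a b = a) in iota_split; last by lia.
  rewrite /k iota_split count_cat.
  rewrite (_ : count _ (iota 0 _) = 0) ?add0n; last first.
    apply/eqP; rewrite -leqn0 leqNgt -has_count; apply/hasPn => x.
    by rewrite mem_iota => /andP[lex ltx]; apply/negP => /and3P[]; lia.
  rewrite -{2}(size_iota (a - b) (minn a b)); apply/eqP; rewrite -all_count.
  apply/allP => x; rewrite mem_iota => /andP[lex ltx].
  have : (x, x + b - a) \in blanks P.
    by apply: (blanks_down heckeP) abP; lia.
  by rewrite mem_blanks => /and3P[_ -> ->]; rewrite andbT; lia.
set q := fun x => _.
(* The height after the crossing is [t.+1], which leaves exactly [minn a b] crossings southeast of
   it. *)
have := @count_diagonal_crossings n P heckeP a b t.+1.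
rewrite !addnS => /(_ lea leb); rewrite -!addnS => /(_ nblankS).
rewrite !addnS height_diag // tileX htt eqxx.
have -> : Crossing != Blank by apply/eqP.
rewrite -/q => cnt.
have {cnt} <- : count q (iota (a + t).+1 (n - (a + t).+1)) = minn a b by lia.
rewrite nth_rev_filter_iota ?addKn //.
have sub : a + t + b - a = b + t by lia.
by rewrite /q sub leb tileX eqxx -addnA leq_addr.
Qed.

Lemma entry_Omega_nblank (a b : nat) : (a, b) \notin blanks P ->
  entry (Omega P) (a, b) = 0.
Proof. by rewrite entry_Omega => /negbTE ->. Qed.

(** The duality. Up to the paired crossing, R(a + u, b + u) stays below [u]: it is 0 in the blanks,
    and afterwards it gains at least 1 per step and ends at T - 1. Past the crossing it is at least
    [u] by [entry_Omega_blank]. *)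
Lemma leq_entry_Omega (a b u : nat) : 0 < u -> a + u <= n -> b + u <= n ->
  (u <= entry (Omega P) (a, b)) = (height P (a + u) (b + u) < u).
Proof.
move=> u_gt0 lea leb; have [abP|abN] := boolP ((a, b) \in blanks P).
  have [] := entry_Omega_blank abP; set t := entry _ _ 
    => t_gt0 lta ltb _ [htt high].
  have [leut|ltut] := leqP u t; last by apply/esym/negbTE; rewrite -leqNgt high.
  have [auP|auN] := boolP ((a + u, b + u) \in blanks P).
    have := height_blank heckeP auP.
    by have := height_diag bpdP (i := a + u) (j := b + u); lia.
  have := height_diag_ge heckeP (d := t - u) _ _ auN.
  by rewrite -!addnA subnKC // htt => /(_ (ltnW lta) (ltnW ltb)); lia.
rewrite entry_Omega_nblank // leqNgt u_gt0; apply/esym/negbTE; rewrite -leqNgt.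
by have := height_diag_ge heckeP lea leb abN; lia.
Qed.

(** At the crossing of the smaller entry [t] the height is [t.-1], hence [t] at the next corner
    below or to the right. By monotonicity the height is below [t.+1] at the corner that tests the
    other cell for [t.+1]. *)
Lemma Omega_decreasing (la : seq nat) : hecke_of_shape la P ->
  decreasing_tableau la (Omega P).
Proof.
case=> _ la_part blankE; split=> //.
- by move=> [i j] /entry_Omega_blank[].
- move=> i j j' ijP ij'P ltj.
  have [] := entry_Omega_blank ij'P; set t := entry _ _.
  move=> t_gt0 lta ltb tileX [htt _].
  rewrite leq_entry_Omega; [|by lia..].
  have : height P (i + t).+1 (j + t.+1) <= height P (i + t).+1 (j' + t).
    by apply: height_le; lia.
  rewrite (height_Sl bpdP lta (ltnW ltb)) htt /left_edge ltb tileX /=.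
  by rewrite !addnS; lia.
- move=> i i' j ijP i'jP lti.
  have [] := entry_Omega_blank i'jP; set t := entry _ _.
  move=> t_gt0 lta ltb tileX [htt _].
  rewrite leq_entry_Omega; [|by lia..].
  have : height P (i + t.+1) (j + t).+1 <= height P (i' + t) (j + t).+1.
    by apply: (height_lel bpdP); lia.
  rewrite [height P (i' + t) _]heightS // htt /top_edge lta tileX /=.
  by rewrite !addnS addn0 prednK.
Qed.

End OmegaHecke.

Lemma Omega_inj (n : nat) (P Q : 'M[tile]_n) : hecke P -> hecke Q ->
  Omega P = Omega Q -> P = Q.
Proof.
move=> hP hQ eqPQ.
have [bP bQ] : is_bpd P /\ is_bpd Q by case: hP hQ => [? []] ? ? ? [? []].
suff le (A B : 'M[tile]_n) : hecke A -> hecke B -> Omega A = Omega B ->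
    forall i j, i <= n -> j <= n -> height A i j <= height B i j.
  by apply: height_inj => // i j lei lej; apply/eqP; rewrite eqn_leq !le.
move=> hA hB eqAB i j lei lej; rewrite leqNgt; apply/negP => ltBA.
have bA : is_bpd A by case: hA => ? [].
(* The cell [(i - k, j - k)] tests the height at [(i, j)] against [k]: its entry would be at least
   [k] for [B] but not for [A]. *)
set k := height A i j in ltBA.
have lei' : k <= i by apply: height_minl.
have lej' : k <= j by apply: height_minr.
have k_gt0 : 0 < k by lia.
have := leq_entry_Omega hA (a := i - k) (b := j - k) k_gt0.
have := leq_entry_Omega hB (a := i - k) (b := j - k) k_gt0.
rewrite eqAB !subnK // => /(_ lei lej) -> /(_ lei lej).
by rewrite ltBA ltnn.
Qed.

(** * The inverse of Omega *)

(** The duality solved for R: R(i, j) < k should hold exactly when [k <= f (i - k) (j - k)]. So R is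
    one less than the least such [k], and [find], which counts from 0, returns [minn i j] if there
    is none. *)
Definition tableau_height (f : nat -> nat -> nat) (i j : nat) : nat :=
  find (fun k => k < f (i - k.+1) (j - k.+1)) (iota 0 (minn i j)).

Section TableauHeight.
Variable f : nat -> nat -> nat.
Hypothesis f_row : forall a b, f a b.+1 <= (f a b).-1.
Hypothesis f_col : forall a b, f a.+1 b <= (f a b).-1.
Let R := tableau_height f.

(** The predecessor in [f_row] and [f_col] is truncated: entries lose at least 1 per step until they
    reach 0, the value off the shape. *)
Lemma entry_decrease (a b d e : nat) : f (a + d) (b + e) <= f a b - d - e.
Proof.
elim: e => [|e IH]; last by have := f_row (a + d) (b + e); rewrite addnS; lia.
elim: d => [|d IH]; first by rewrite !addn0 !subn0.
by have := f_col (a + d) (b + 0); rewrite addnS; lia.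
Qed.

Lemma tableau_height_min (i j : nat) : R i j <= minn i j.
Proof.
by rewrite /R /tableau_height -{2}(size_iota 0 (minn i j)) find_size.
Qed.

(** A step northwest raises a positive entry by at least 2, so the condition on [k] persists for
    larger [k] and its least solution decides it. *)
Lemma leq_tableau (i j k : nat) : 0 < k -> k <= minn i j ->
  (k <= f (i - k) (j - k)) = (R i j < k).
Proof.
move=> k_gt0 lek; set p := fun k => k < f (i - k.+1) (j - k.+1).
have pS d : d.+1 < minn i j -> p d -> p d.+1.
  move=> ltd; rewrite /p => pd.
  have := f_row (i - d.+1) (j - d.+2); have := f_col (i - d.+2) (j - d.+2).
  have -> : (i - d.+2).+1 = i - d.+1 by lia.
  have -> : (j - d.+2).+1 = j - d.+1 by lia.
  by lia.
have mono d e : d <= e -> e < minn i j -> p d -> p e.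
  move=> /subnK <-; elim: (e - d) => // c IH ltc pd.
  by rewrite addSn pS // IH // ltnW.
have kE : k = k.-1.+1 by lia.
rewrite kE ltnS -/(p k.-1); apply/idP/idP => [pk|leR].
  rewrite leqNgt; apply/negP => ltR.
  have := before_find 0 ltR; rewrite nth_iota ?add0n; last by lia.
  by rewrite -/(p k.-1) pk.
have lt_min : R i j < minn i j by lia.
apply: mono leR _ _; first by lia.
have : has p (iota 0 (minn i j)) by rewrite has_find size_iota.
by move=> /(nth_find 0); rewrite nth_iota // add0n.
Qed.

Variable n : nat.
Hypothesis f_max : f 0 0 <= n.-1.

Lemma entry_bound (a b : nat) : f a b <= n.-1 - a - b.
Proof. by have := entry_decrease 0 0 a b; rewrite !add0n; lia. Qed.

(** By duality each bound on a step of R compares two adjacent entries: monotonicity compares them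
    in the direction of the step, the bound by 1 in the other direction. *)
Lemma tableau_height_function : height_function n R.
Proof.
have bound := entry_bound.
split=> [j _|i _|j lej|i lei|i j lei ltj|i j lti lej].
- by have := tableau_height_min 0 j; lia.
- by have := tableau_height_min i 0; lia.
(* A value below [j] would give [j <= f (n - j) 0], against the bound [n.-1 - (n - j)]. *)
- have := tableau_height_min n j; have [->|j_gt0] := posnP j; first by lia.
  by have := @leq_tableau n j j; have := bound (n - j) (j - j); lia.
- have := tableau_height_min i n; have [->|i_gt0] := posnP i; first by lia.
  by have := @leq_tableau i n i; have := bound (i - i) (n - i); lia.
- have min1 := tableau_height_min i j; have min2 := tableau_height_min i j.+1.
  apply/andP; split.
    rewrite leqNgt; apply/negP => ltR; set k := R i j in ltR min1.
    have := @leq_tableau i j k; have := @leq_tableau i j.+1 k.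
    have := f_row (i - k) (j - k).
    have -> : (j - k).+1 = j.+1 - k by lia.
    by rewrite -/k; lia.
  rewrite leqNgt; apply/negP => ltR; set k := (R i j).+1.
  have := @leq_tableau i j k; have := @leq_tableau i j.+1 k.+1.
  have := f_col (i - k.+1) (j - k).
  have -> : (i - k.+1).+1 = i - k by lia.
  by rewrite subSS; lia.
- have min1 := tableau_height_min i j; have min2 := tableau_height_min i.+1 j.
  apply/andP; split.
    rewrite leqNgt; apply/negP => ltR; set k := R i j in ltR min1.
    have := @leq_tableau i j k; have := @leq_tableau i.+1 j k.
    have := f_col (i - k) (j - k).
    have -> : (i - k).+1 = i.+1 - k by lia.
    by rewrite -/k; lia.
  rewrite leqNgt; apply/negP => ltR; set k := (R i j).+1.
  have := @leq_tableau i j k; have := @leq_tableau i.+1 j k.+1.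
  have := f_row (i - k) (j - k.+1).
  have -> : (j - k.+1).+1 = j - k by lia.
  by rewrite subSS; lia.
Qed.

Lemma blanks_tableau (a b : nat) :
  ((a, b) \in blanks (bpd_of_height n R)) = (0 < f a b).
Proof.
have hfR := tableau_height_function.
have bpdP := bpd_of_height_bpd hfR.
have RS : (0 < f a b) = (R a.+1 b.+1 < 1).
  by rewrite -(@leq_tableau a.+1 b.+1 1) ?subn1 //; lia.
rewrite mem_blanks; have := entry_bound a b.
have [lta|gea] := ltnP a n; last by case: posnP => //=; lia.
have [ltb|geb] := ltnP b n; last by case: posnP => //=; lia.
have := height_diag bpdP lta ltb.
rewrite !(height_bpd_of_height hfR) ?(ltnW lta, ltnW ltb) //.
move=> diag bnd /=; apply/idP/idP => [Pab|f_gt0]; last first.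
  by case: eqP diag => // _; case: eqP; lia.
case: posnP => // f0; move: diag; rewrite (eqP Pab) eqxx.
case: eqP => // _; rewrite !addn0 => diag.
have := tableau_height_min a b; have := tableau_height_min a.+1 b.+1.
(* A blank with [f a b = 0] would have the same height [k > 0] at both corners. The tests of [k] at
   [(a, b)] and of [k.+1] at [(a.+1, b.+1)] look at one and the same entry and contradict each
   other. *)
set k := R a b in diag *; move=> min1 min2.
have := @leq_tableau a b k; have := @leq_tableau a.+1 b.+1 k.+1.
by rewrite !subSS -/k diag; lia.
Qed.

End TableauHeight.

Lemma tableau_steps (la : seq nat) (T : filling) (a b : nat) :
  decreasing_tableau la T ->
  entry T (a, b.+1) <= (entry T (a, b)).-1 /\
  entry T (a.+1, b) <= (entry T (a, b)).-1.
Proof.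
case=> la_part domT T_gt0 T_row T_col.
have T0 c : c \notin domf T -> entry T c = 0.
  by move=> cN; rewrite /entry not_fnd.
split.
  have [abT|/T0-> //] := boolP ((a, b.+1) \in domf T).
  have ab : (a, b) \in domf T by move: abT; rewrite domT; apply: young_down.
  by have := T_row _ _ _ ab abT (leqnn _); lia.
have [abT|/T0-> //] := boolP ((a.+1, b) \in domf T).
have ab : (a, b) \in domf T by move: abT; rewrite domT; apply: young_down.
by have := T_col _ _ _ ab abT (leqnn _); lia.
Qed.

(** The BPD is built from [tableau_height]. Then [Omega P] and [T] obey the duality with the same
    heights, so they pass the same thresholds. *)
Lemma Omega_surj (n : nat) (la : seq nat) (T : filling) :
  decreasing_tableau la T -> (forall c, c \in domf T -> entry T c <= n.-1) ->
  exists2 P : 'M[tile]_n, hecke P & Omega P = T.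
Proof.
move=> decT T_max; have [la_part domT T_gt0 _ _] := decT.
pose f a b := entry T (a, b).
have f0 a b : (a, b) \notin domf T -> f a b = 0.
  by move=> abN; rewrite /f /entry not_fnd.
have f_gt0 a b : (0 < f a b) = ((a, b) \in domf T).
  by have [/T_gt0|/f0->] := boolP ((a, b) \in domf T).
have f_row a b : f a b.+1 <= (f a b).-1 := (tableau_steps a b decT).1.
have f_col a b : f a.+1 b <= (f a b).-1 := (tableau_steps a b decT).2.
have f_max : f 0 0 <= n.-1.
  by have [/T_max|/f0->] := boolP ((0, 0) \in domf T).
have hfR := tableau_height_function f_row f_col f_max.
set P := bpd_of_height n (tableau_height f).
have blankP : blanks P = domf T.
  by apply/fsetP => -[a b]; rewrite blanks_tableau // f_gt0.
have bpdP : is_bpd P := bpd_of_height_bpd hfR.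
have heckeP : hecke P by exists la; split; rewrite // blankP.
have domO : domf (Omega P) = domf T by rewrite -blankP.
exists P => //; apply/fmapP => -[a b].
suff eqE : entry (Omega P) (a, b) = entry T (a, b).
  have [abT|abN] := boolP ((a, b) \in domf T); last first.
    have abO : (a, b) \notin domf (Omega P) by rewrite domO.
    by rewrite (not_fnd abO) (not_fnd abN).
  move: eqE; rewrite /entry (in_fnd abT).
  have abP : (a, b) \in domf (Omega P) by rewrite domO.
  by rewrite (in_fnd abP) /= => ->.
have leT u : 0 < u -> a + u <= n -> b + u <= n ->
    (u <= entry (Omega P) (a, b)) = (u <= f a b).
  move=> u_gt0 lea leb; rewrite leq_entry_Omega // height_bpd_of_height //.
  by rewrite -(leq_tableau f_row f_col) ?addnK //; lia.
have [abT|abN] := boolP ((a, b) \in domf T); last first.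
  by rewrite entry_Omega_nblank ?blankP // -/(f a b) f0.
have abP : (a, b) \in blanks P by rewrite blankP.
have [t_gt0 lta ltb _ _] := entry_Omega_blank heckeP abP.
have := leT _ t_gt0 (ltnW lta) (ltnW ltb); rewrite leqnn => /esym le1.
have fab_gt0 : 0 < f a b by rewrite f_gt0.
have bnd := entry_bound f_row f_col f_max a b.
have := leT _ fab_gt0; rewrite leqnn => le2.
by apply/eqP; rewrite eqn_leq le1 le2 //; lia.
Qed.

(** * Labels as states of a wiring diagram *)

Section Wiring.
Variables (n : nat) (rule : crossing_rule n).
Implicit Types (u : nat -> label n) (w : seq nat).

(* A state lists the labels met by a cut from the northwest to the southeast
   corner; the cut passes the top edge of a tile before its right edge. *)
Definition wire_step u (r : nat) : nat -> label n := fun p =>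
  if p == r then (rule (u r) (u r.+1)).2
  else if p == r.+1 then (rule (u r) (u r.+1)).1 else u p.

Definition wire_run u w : nat -> label n := foldl wire_step u w.

Lemma wire_run_out u w (p : nat) :
  all (fun r => (p != r) && (p != r.+1)) w -> wire_run u w p = u p.
Proof.
elim: w u => //= r w IH u /andP[/andP[neq neqS] allw].
by rewrite IH // /wire_step (negbTE neq) (negbTE neqS).
Qed.

Fixpoint wire_pairs u w : seq (label n * label n) :=
  if w is r :: w' then (u r, u r.+1) :: wire_pairs (wire_step u r) w'
  else [::].

Lemma wire_run_cat u w w' : wire_run u (w ++ w') = wire_run (wire_run u w) w'.
Proof. exact: foldl_cat. Qed.

Lemma wire_pairs_cat u w w' :
  wire_pairs u (w ++ w') = wire_pairs u w ++ wire_pairs (wire_run u w) w'.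
Proof. by elim: w u => //= r w IH u; rewrite IH. Qed.

End Wiring.

Section Simulation.
Variables (n : nat) (P : 'M[tile]_n) (rule : crossing_rule n).
Hypothesis bpdP : is_bpd P.

Definition row_crossings (i j : nat) : seq (nat * nat) :=
  [seq (i, k) | k <- iota 0 j & tile_at P i k == Crossing].

Fixpoint crossings_below (h : nat) : seq (nat * nat) :=
  if h is h'.+1 then crossings_below h' ++ row_crossings (n - h'.+1) n
  else [::].

Definition heights (s : seq (nat * nat)) : seq nat :=
  [seq height P c.1 c.2 | c <- s].

Let run := @wire_run n rule.

Lemma row_crossingsS (i j : nat) : row_crossings i j.+1 =
  row_crossings i j ++ if tile_at P i j == Crossing then [:: (i, j)] else [::].
Proof.
rewrite /row_crossings -[X in iota 0 X]addn1 iotaD filter_cat map_cat /=.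
by case: ifP.
Qed.

Lemma row_crossings_split (i j k : nat) : j <= k -> exists s,
  row_crossings i k = row_crossings i j ++ s /\
  {subset s <= [seq (i, l) | l <- iota j (k - j) & tile_at P i l == Crossing]}.
Proof.
move=> lejk; eexists; rewrite /row_crossings -{1}(subnKC lejk) iotaD.
by rewrite filter_cat map_cat; split; [reflexivity|].
Qed.

Lemma crossing_heights (i k : nat) : i < n -> k < n ->
  tile_at P i k = Crossing ->
  [/\ height P i k.+1 = (height P i k).+1, height P i.+1 k = (height P i k).+1
    & height P i.+1 k.+1 = (height P i k).+2].
Proof.
move=> lti ltk tileX; rewrite !height_Sl // ?(ltnW ltk) // !heightS.
rewrite -(right_left_edge bpdP lti ltk) /top_edge /left_edge lti ltk tileX.
by rewrite !addn1.
Qed.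

(** A crossing before column [j] moves only positions below R(i + 1, j), since its own lower right
    corner already has height two more than its first position. *)
Lemma run_row_above (u : nat -> label n) (i j p : nat) : i < n -> j <= n ->
  height P i.+1 j <= p -> run u (heights (row_crossings i j)) p = u p.
Proof.
move=> lti lej lep; apply: wire_run_out; apply/allP => r.
move=> /mapP[c /mapP[k]]; rewrite mem_filter mem_iota add0n.
case/andP=> /eqP tileX /andP[_ ltk] -> ->; have ltkn := leq_trans ltk lej.
have [_ _ e] := crossing_heights lti ltkn tileX.
have := height_le P i.+1 ltk; rewrite e /= => /leq_trans/(_ lep).
by lia.
Qed.

(** Crossings from column [j] on act at positions R(i, j) or beyond. *)
Lemma run_row_below (u : nat -> label n) (i j p : nat) : i < n -> j <= n ->
  p < height P i j ->
  run u (heights (row_crossings i n)) p = run u (heights (row_crossings i j)) p.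
Proof.
move=> lti lej ltp; have [s [-> subs]] := row_crossings_split i lej.
rewrite /heights map_cat -/(heights _) /run wire_run_cat; apply: wire_run_out.
apply/allP => r /mapP[c /subs/mapP[k]]; rewrite mem_filter mem_iota.
case/andP=> _ /andP[lek _] -> ->; have := height_le P i lek.
by move=> /(leq_trans ltp) /=; lia.
Qed.

Section Row.
Variables (i : nat) (u : nat -> label n) (v : nat -> label n).
Hypothesis lti : i < n.
Hypothesis vE : forall j, j < n ->
  v j = if top_edge P i.+1 j then u (height P i.+1 j) else None.

Let state j := run u (heights (row_crossings i j)).

Lemma row_state_below (j : nat) : j < n ->
  v j = if top_edge P i.+1 j then state j (height P i.+1 j) else None.
Proof. by move=> ltj; rewrite vE // /state run_row_above // ltnW. Qed.

Lemma state_crossing (j : nat) : j < n -> tile_at P i j = Crossing ->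
  state j.+1 = wire_step rule (state j) (height P i j).
Proof.
move=> ltj tileX; rewrite /state row_crossingsS tileX eqxx /heights map_cat.
by rewrite /run wire_run_cat.
Qed.

Lemma state_not_crossing (j : nat) : tile_at P i j != Crossing ->
  state j.+1 = state j.
Proof. by move=> /negbTE tileN; rewrite /state row_crossingsS tileN cats0. Qed.

(** The cut just before a tile has the left edge at position R(i, j) and the bottom edge at R(i + 1,
    j); a case analysis of the tile carries this across it. [vE] is the corresponding claim for the
    line under the row. *)
Lemma row_labelE (j : nat) : j <= n ->
  row_label rule (tile_at P i) v j =
    if left_edge P i j then state j (height P i j) else None.
Proof.
elim: j => [|j IH] ltj; first by rewrite left_edge0.
rewrite /= (IH (ltnW ltj)) (row_state_below ltj).
rewrite -(right_left_edge bpdP lti ltj) -(bottom_top_edge bpdP lti ltj).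
rewrite (height_Sl bpdP lti (ltnW ltj)) heightS /left_edge /top_edge lti ltj.
have [tileX|tileN] := eqVneq (tile_at P i j) Crossing.
  rewrite state_crossing // tileX /= !addn1 /wire_step eqxx.
  by rewrite eqn_leq ltnn.
rewrite state_not_crossing //; move: tileN.
by case: (tile_at P i j) => //=; rewrite ?eqxx ?addn0.
Qed.

Lemma row_top_labelE (j : nat) : j < n ->
  (route rule (tile_at P i j) (row_label rule (tile_at P i) v j) (v j)).2 =
    if top_edge P i j then state n (height P i j) else None.
Proof.
move=> ltj; rewrite (row_labelE (ltnW ltj)) (row_state_below ltj).
rewrite -(bottom_top_edge bpdP lti ltj).
rewrite (height_Sl bpdP lti (ltnW ltj)) /left_edge ltj.
case: (boolP (top_edge P i j)) => [top|]; last first.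
  by rewrite /top_edge lti; case: (tile_at P i j).
have -> : state n (height P i j) = state j.+1 (height P i j).
  by apply: run_row_below => //; rewrite heightS top addn1.
move: top; rewrite /top_edge lti.
have [tileX|tileN] := eqVneq (tile_at P i j) Crossing.
  by rewrite state_crossing // tileX /= addn1 /wire_step eqxx.
rewrite state_not_crossing //; move: tileN.
by case: (tile_at P i j) => //=; rewrite ?eqxx ?addn0.
Qed.

End Row.

Definition state_below (h : nat) : nat -> label n :=
  run (fun p => insub p) (heights (crossings_below h)).

Lemma state_belowS (h : nat) :
  state_below h.+1 =
    run (state_below h) (heights (row_crossings (n - h.+1) n)).
Proof. by rewrite /state_below /heights /= map_cat /run wire_run_cat. Qed.

Lemma line_labelE (h j : nat) : h <= n -> j < n ->
  line_label rule P h j =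
    if top_edge P (n - h) j then state_below h (height P (n - h) j) else None.
Proof.
elim: h j => [|h IH] j leh ltj.
  by rewrite subn0 /top_edge ltnn height_nj.
have lti : n - h.+1 < n by lia.
have eqS : (n - h.+1).+1 = n - h by lia.
rewrite state_belowS /= (@row_top_labelE _ (state_below h)) // => k ltk.
by rewrite (IH _ (ltnW leh) ltk) eqS.
Qed.

Lemma label_belowE (i j : nat) : i < n -> j < n ->
  label_below rule P i j =
    if top_edge P i.+1 j then state_below (n - i.+1) (height P i.+1 j)
    else None.
Proof.
move=> lti ltj; rewrite /label_below line_labelE //; last by lia.
by have -> : n - (n - i.+1) = i.+1 by lia.
Qed.

Let cell_state i j :=
  run (state_below (n - i.+1)) (heights (row_crossings i j)).

Lemma label_leftE (i j : nat) : i < n -> j <= n ->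
  label_left rule P i j =
    if left_edge P i j then cell_state i j (height P i j) else None.
Proof.
by move=> lti lej; apply: row_labelE => // k ltk; apply: label_belowE.
Qed.

Lemma crossing_labels (i j : nat) : i < n -> j < n ->
  tile_at P i j = Crossing ->
  label_left rule P i j = cell_state i j (height P i j) /\
  label_below rule P i j = cell_state i j (height P i j).+1.
Proof.
move=> lti ltj tileX; have [_ <- _] := crossing_heights lti ltj tileX.
rewrite (label_leftE lti (ltnW ltj)) (label_belowE lti ltj).
rewrite /left_edge ltj tileX.
rewrite -(bottom_top_edge bpdP) // tileX /=; split=> //.
by rewrite /cell_state run_row_above // ltnW.
Qed.

(** A pipe that has reached the right boundary in row [i] stays at position [i]: the rows above act
    on smaller positions only. *)
Lemma state_below_out (i h : nat) : i < n -> n - i <= h <= n ->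
  state_below h i = state_below (n - i) i.
Proof.
move=> lti /andP[]; move=> /subnK <-; elim: (h - _) => // d IH leh.
rewrite addSn in leh *; rewrite state_belowS run_row_above ?IH //; try lia.
by rewrite height_in //; lia.
Qed.

Lemma label_right_boundary (i : nat) : i < n ->
  label_left rule P i n = state_below n i.
Proof.
move=> lti; rewrite label_leftE // /left_edge ltnn (height_in bpdP (ltnW lti)).
rewrite (state_below_out lti) ?leq_subr //= /cell_state.
have eqS : n - i = (n - i.+1).+1 by lia.
by rewrite [in RHS]eqS state_belowS -eqS subKn // ltnW.
Qed.

Lemma wire_pairs_row (i j : nat) : i < n -> j <= n ->
  wire_pairs rule (state_below (n - i.+1)) (heights (row_crossings i j)) =
  [seq (label_left rule P c.1 c.2, label_below rule P c.1 c.2)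
     | c <- row_crossings i j].
Proof.
move=> lti; elim: j => // j IH ltj; rewrite row_crossingsS /heights !map_cat.
rewrite wire_pairs_cat (IH (ltnW ltj)); congr (_ ++ _).
case: eqP => // tileX /=; have [-> ->] := crossing_labels lti ltj tileX.
by [].
Qed.

Lemma wire_pairs_below (h : nat) : h <= n ->
  wire_pairs rule (fun p => insub p) (heights (crossings_below h)) =
  [seq (label_left rule P c.1 c.2, label_below rule P c.1 c.2)
     | c <- crossings_below h].
Proof.
elim: h => // h IH leh.
rewrite /= /heights !map_cat wire_pairs_cat (IH (ltnW leh)).
congr (_ ++ _); rewrite -wire_pairs_row //; last by lia.
by have -> : n - (n - h.+1).+1 = h by lia.
Qed.

End Simulation.

(** * Words and inversions *)

Section WordPermutations.
Variable n : nat.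
Implicit Types (w : 'S_n) (x y : 'I_n) (a : seq nat).

Definition perm_labels w (p : nat) : label n := omap w (insub p).

Lemma perm_labels1 : perm_labels 1%g = fun p => insub p.
Proof.
apply/funext => p; rewrite /perm_labels.
by case: insub => //= x; rewrite perm1.
Qed.

Lemma perm_labels_ord w x : perm_labels w x = Some (w x).
Proof. by rewrite /perm_labels valK. Qed.

Lemma simple_transpositionE x y : y = x.+1 :> nat ->
  simple_transposition n x.+1 = tperm x y.
Proof. by move=> eqy; rewrite /simple_transposition /= -eqy !valK. Qed.

Lemma word_perm_cons (k : nat) a :
  word_perm n (k :: a) = (word_perm n a * simple_transposition n k)%g.
Proof. by rewrite /word_perm rev_cons -cats1 big_cat big_seq1. Qed.

(** The step permutes positions, and [(s * w) p] is [w (s p)], so the transposition multiplies on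
    the left. Position [r], from 0, becomes the letter [r.+1]. *)
Lemma straight_step w (r : nat) : r.+1 < n ->
  wire_step (@straight n) (perm_labels w) r =
    perm_labels (simple_transposition n r.+1 * w).
Proof.
move=> ltr; have /ord_cases[y eqy] := ltr.
have /ord_cases[x eqx] := ltnW ltr; rewrite eqx in eqy *.
rewrite (simple_transpositionE (esym eqy)); apply/funext => p.
rewrite /wire_step /= eqy !perm_labels_ord.
have [eqp|nepx] := eqVneq; first by rewrite eqp perm_labels_ord permM tpermL.
have [eqp|nepy] := eqVneq; first by rewrite eqp perm_labels_ord permM tpermR.
rewrite /perm_labels; case: insubP => //= z _ eqz.
by rewrite permM tpermD // -val_eqE /= eqz eq_sym.
Qed.

Lemma straight_run w a : all (fun r => r.+1 < n) a ->
  wire_run (@straight n) (perm_labels w) a =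
    perm_labels (word_perm n (map S a) * w).
Proof.
elim: a w => [|r a IH] w /=; first by rewrite /word_perm big_nil mul1g.
by move=> /andP[ltr /IH{}IH]; rewrite straight_step // IH word_perm_cons mulgA.
Qed.

Definition crosses x y (d : label n * label n) : bool :=
  ((d.1 == Some x) && (d.2 == Some y)) || ((d.1 == Some y) && (d.2 == Some x)).

(* Inversions are recorded by values: a crossing then toggles exactly one of
   them. *)
Definition value_inversion w x y : bool :=
  (x < y) && ((w^-1)%g y < (w^-1)%g x).

Lemma inversionsE w :
  inversions w = #|[pred p : 'I_n * 'I_n | value_inversion w p.1 p.2]|.
Proof.
rewrite /inversions -!sum1_card.
pose h (p : 'I_n * 'I_n) := ((w^-1)%g p.2, (w^-1)%g p.1).
rewrite (reindex_onto h (fun p => (w p.2, w p.1))) /=; last first.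
  by move=> [x y] _; rewrite /h /= !permK.
apply: eq_bigl => -[x y]; rewrite !inE /h /= /value_inversion !permKV.
by rewrite eqxx andbT andbC.
Qed.

(** Exchanging two neighbouring positions reverses the order of the two values there and of no other
    pair. *)
Lemma value_inversion_step w x y (r : nat) : r.+1 < n -> x < y ->
  value_inversion (simple_transposition n r.+1 * w) x y =
  value_inversion w x y (+) crosses x y (perm_labels w r, perm_labels w r.+1).
Proof.
move=> ltr ltxy; have /ord_cases[q eqq] := ltr.
have /ord_cases[p eqp] := ltnW ltr; rewrite eqp in eqq *.
rewrite (simple_transpositionE (esym eqq)) eqq !perm_labels_ord.
rewrite /value_inversion /crosses ltxy /= invMg tpermV !permM.
have eqS z t : (Some (w z) == Some t :> label n) = (z == (w^-1)%g t).
  exact: (canF_eq (permK w)).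
rewrite !eqS.
have : (w^-1)%g x != (w^-1)%g y.
  by rewrite (inj_eq perm_inj) neq_ltn ltxy.
move: ((w^-1)%g x) ((w^-1)%g y) => A B.
rewrite -!val_eqE /=.
by case: tpermP => [->|->|/eqP + /eqP]; case: tpermP => [->|->|/eqP + /eqP];
  rewrite -?val_eqE /=; lia.
Qed.

Lemma value_inversion_run w x y a : all (fun r => r.+1 < n) a -> x < y ->
  value_inversion (word_perm n (map S a) * w) x y =
  value_inversion w x y
    (+) odd (count (crosses x y) (wire_pairs (@straight n) (perm_labels w) a)).
Proof.
move=> + ltxy; elim: a w => [|r a IH] w /=.
  by rewrite /word_perm big_nil mul1g addbF.
move=> /andP[ltr /IH{}IH]; rewrite word_perm_cons -mulgA IH straight_step //.
by rewrite value_inversion_step // oddD -addbA oddb.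
Qed.

Lemma wire_pairs_labels w a d : all (fun r => r.+1 < n) a ->
  d \in wire_pairs (@straight n) (perm_labels w) a ->
  exists x y, x != y /\ d = (Some x, Some y).
Proof.
elim: a w => //= r a IH w /andP[ltr /IH{}IH]; rewrite inE => /predU1P[->|].
  have /ord_cases[q eqq] := ltr; have /ord_cases[p eqp] := ltnW ltr.
  exists (w p), (w q); rewrite eqq eqp !perm_labels_ord (inj_eq perm_inj).
  by split=> //; rewrite -val_eqE /=; lia.
by rewrite straight_step //; apply: IH.
Qed.

Lemma sum_crosses x y : x != y ->
  \sum_(p : 'I_n * 'I_n | p.1 < p.2) crosses p.1 p.2 (Some x, Some y) = 1.
Proof.
have eqS z t : (Some z == Some t :> label n) = (z == t) by [].
wlog ltxy : x y / x < y => [th nexy|_].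
  have [ltxy|ltyx|/val_inj eqxy] := ltngtP x y; first exact: th.
    rewrite -[RHS](th _ _ ltyx) 1?eq_sym //; apply: eq_bigr => p _.
    by rewrite /crosses /= orbC [X in _ || X]andbC [X in X || _]andbC.
  by rewrite eqxy eqxx in nexy.
rewrite (bigD1 (x, y)) //= /crosses /= !eqxx /= big1 // => -[z t] /=.
case/andP=> ltzt; rewrite !eqS xpair_eqE -!val_eqE /=; lia.
Qed.

Lemma size_wire_pairs w a : all (fun r => r.+1 < n) a ->
  size a = \sum_(p : 'I_n * 'I_n | p.1 < p.2)
    count (crosses p.1 p.2) (wire_pairs (@straight n) (perm_labels w) a).
Proof.
move=> alla.
have -> : size a = size (wire_pairs (@straight n) (perm_labels w) a).
  by elim: (a) (perm_labels w) => //= r b IH u; rewrite -IH.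
have := @wire_pairs_labels w a ^~ alla.
elim: (wire_pairs _ _ _) => [|d s IH] lab.
  by rewrite big1.
rewrite /= big_split /= -IH => [|e es]; last by apply: lab; rewrite inE es orbT.
have [x [y [nexy ->]]] := lab d (mem_head _ _).
by rewrite sum_crosses.
Qed.

(** Summed over pairs of labels, the numbers of crossings give the size of the word and their
    parities give the inversions. Termwise the parity is at most the number, with equality when the
    number is at most 1. *)
Lemma reduced_word_crosses a : all (fun r => r.+1 < n) a ->
  (size a == inversions (word_perm n (map S a))) =
  [forall (p : 'I_n * 'I_n | p.1 < p.2),
    count (crosses p.1 p.2)
      (wire_pairs (@straight n) (fun q => insub q) a) <= 1].
Proof.
move=> alla.
rewrite -perm_labels1 (size_wire_pairs 1%g alla) inversionsE eq_sym.
have -> : #|[pred p | value_inversion (word_perm n (map S a)) p.1 p.2]| =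
    \sum_(p : 'I_n * 'I_n | p.1 < p.2) odd (count (crosses p.1 p.2)
      (wire_pairs (@straight n) (perm_labels 1%g) a)).
  rewrite -sum1_card big_mkcond [RHS]big_mkcond; apply: eq_bigr => -[x y] _.
  rewrite inE /=; case: ltnP => [ltxy|geyx]; last first.
    by rewrite /value_inversion ltnNge geyx.
  have := value_inversion_run 1%g alla ltxy; rewrite mulg1 => ->.
  rewrite {1}/value_inversion invg1 !perm1 [y < x]ltnNge (ltnW ltxy).
  rewrite andbF addFb.
  by case: odd.
pose F (p : 'I_n * 'I_n) := count (crosses p.1 p.2)
  (wire_pairs (@straight n) (perm_labels 1%g) a).
suff le (p : 'I_n * 'I_n) : p.1 < p.2 -> odd (F p) <= F p ?= iff (F p <= 1).
  by have [_ ->] := leqif_sum le.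
by move=> _; split; case: (F p) => [|[|c]] //=; case: odd.
Qed.

(** The invariant allows each pair one event in all, an inversion already made or a crossing still
    to come. Two labels that meet are therefore not yet inverted, and the Demazure rule lets them go
    straight. *)
Lemma demazure_run w a : all (fun r => r.+1 < n) a ->
  (forall x y, x < y -> value_inversion w x y +
     count (crosses x y) (wire_pairs (@straight n) (perm_labels w) a) <= 1) ->
  wire_run (@demazure_rule n) (perm_labels w) a =
    wire_run (@straight n) (perm_labels w) a.
Proof.
elim: a w => //= r a IH w /andP[ltr alla] once.
suff -> : wire_step (@demazure_rule n) (perm_labels w) r =
          wire_step (@straight n) (perm_labels w) r.
  rewrite straight_step // in once *; apply: IH => // x y ltxy.
  have := once x y ltxy; rewrite value_inversion_step //.
  by case: value_inversion; case: crosses => /=; lia.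
have /ord_cases[q eqq] := ltr; have /ord_cases[p eqp] := ltnW ltr.
have ltw : w p < w q.
  rewrite ltnNge; apply/negP; rewrite leq_eqVlt.
  move=> /predU1P[/val_inj/perm_inj|lt].
    by move/(congr1 val) => /=; lia.
  have := once _ _ lt; rewrite eqq eqp !perm_labels_ord.
  rewrite /value_inversion lt !permK /crosses /= !eqxx orbT /=.
  by rewrite -eqq -eqp ltnSn.
apply/funext => p'; rewrite /wire_step eqq eqp !perm_labels_ord /=.
by rewrite (ltnW ltw).
Qed.

End WordPermutations.

(** The first element [x] of [s1] is moved to the front of [s2]. Each [y] it passes comes after [x]
    in [s1] and before [x] in [s2], so their factors commute. *)
Lemma big_commuting_reorder (gT : finGroupType) (I : eqType) (f : I -> gT)
    (r1 r2 : rel I) (s1 s2 : seq I) :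
  pairwise r1 s1 -> pairwise r2 s2 -> perm_eq s1 s2 ->
  (forall x y, x \in s1 -> y \in s1 -> r1 x y -> r2 y x ->
     commute (f x) (f y)) ->
  (\prod_(x <- rev s1) f x = \prod_(x <- rev s2) f x)%g.
Proof.
elim: s1 s2 => [|x s1 IH] s2 /=.
  by move=> _ _; rewrite perm_sym => /perm_nilP -> _; rewrite !big_nil.
case/andP=> /allP r1x pw1 pw2 eqs comm.
have : x \in s2 by rewrite -(perm_mem eqs) mem_head.
move=> /splitPr xs2; case: s2 / xs2 pw2 eqs => p q pw2 eqs.
have eqs' : perm_eq s1 (p ++ q).
  by rewrite -(perm_cons x) (permPl eqs) perm_catC /= perm_cons perm_catC.
move: pw2; rewrite pairwise_cat /= => /and4P[/allrelP r2p pwp _ pwq].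
have pw' : pairwise r2 (p ++ q).
  by rewrite pairwise_cat pwp pwq !andbT; apply/allrelP => y z yp zq;
    apply: r2p => //; rewrite inE zq orbT.
rewrite rev_cons -cats1 big_cat big_seq1.
rewrite (IH _ pw1 pw' eqs') => [|y z ys zs]; last first.
  by apply: comm; rewrite inE ?ys ?zs orbT.
rewrite !rev_cat rev_cons -cats1 !big_cat big_seq1 /= -!mulgA; congr (_ * _)%g.
have {}comm y : y \in p -> commute (f x) (f y).
  move=> yp; have ys : y \in s1 by rewrite (perm_mem eqs') mem_cat yp.
  apply: comm; rewrite ?mem_head ?inE ?ys ?orbT //; first exact: r1x.
  by apply: r2p; rewrite ?mem_head.
elim: (p) comm => [|y p' IHp] comm; first by rewrite big_nil mulg1 mul1g.
rewrite rev_cons -cats1 big_cat big_seq1 /= -mulgA.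
rewrite -comm ?mem_head // !mulgA IHp //.
by move=> z zp; apply: comm; rewrite inE zp orbT.
Qed.

Lemma simple_transposition_commute (n k l : nat) : 0 < k -> k.+1 < l ->
  commute (simple_transposition n k) (simple_transposition n l).
Proof.
move=> k_gt0 ltkl; rewrite /simple_transposition.
case: insubP => [a _ eqa|_]; last by rewrite /commute mul1g mulg1.
case: insubP => [b _ eqb|_]; last by rewrite /commute mul1g mulg1.
case: insubP => [c _ eqc|_]; last by rewrite /commute mul1g mulg1.
case: insubP => [d _ eqd|_]; last by rewrite /commute mul1g mulg1.
rewrite /= in eqa eqb eqc eqd; apply/commgP/conjg_fixP.
by rewrite tpermJ !tpermD // -val_eqE /=; lia.
Qed.

(** * The word of the crossings *)

Definition row_order (c d : nat * nat) : bool :=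
  (d.1 < c.1) || ((c.1 == d.1) && (c.2 < d.2)).

Lemma card_count (T : finType) (A : pred T) :
  #|[pred x | A x]| = count A (enum T).
Proof. by rewrite cardE enumT /enum_mem size_filter; apply: eq_count. Qed.

Section Crossings.
Variables (n : nat) (P : 'M[tile]_n).

Lemma mem_row_crossings (i j : nat) (c : nat * nat) :
  (c \in row_crossings P i j) =
  [&& c.1 == i, c.2 < j & tile_at P c.1 c.2 == Crossing].
Proof.
apply/mapP/and3P => [[k]|[/eqP <- ltj tileX]].
  by rewrite mem_filter mem_iota => /andP[tileX ltj] ->.
by exists c.2; [rewrite mem_filter tileX mem_iota | case: (c)].
Qed.

Lemma mem_crossings_below (h : nat) (c : nat * nat) : h <= n ->
  (c \in crossings_below P h) =
  [&& n - h <= c.1, c.1 < n & (c.2 < n) && (tile_at P c.1 c.2 == Crossing)].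
Proof.
elim: h => [|h IH] leh; first by rewrite subn0 in_nil; lia.
rewrite mem_cat (IH (ltnW leh)) mem_row_crossings.
by case: (_ == Crossing); lia.
Qed.

Lemma pairwise_crossings_below (h : nat) : h <= n ->
  pairwise row_order (crossings_below P h).
Proof.
elim: h => // h IH leh; rewrite /= pairwise_cat (IH (ltnW leh)).
apply/and3P; split=> //.
  apply/allrelP => c d; rewrite (mem_crossings_below _ (ltnW leh)).
  rewrite mem_row_crossings => /and3P[lec _ _] /and3P[/eqP eqd _ _].
  by rewrite /row_order eqd; lia.
rewrite pairwise_map; apply: pairwise_filter.
apply: (@sub_pairwise _ ltn).
  by move=> k l /=; rewrite /row_order /= ltnn eqxx.
by rewrite -sorted_pairwise ?iota_ltn_sorted //; apply: ltn_trans.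
Qed.

Lemma uniq_crossings_below (h : nat) : h <= n -> uniq (crossings_below P h).
Proof.
move=> /pairwise_crossings_below; elim: crossings_below => //= c s IH.
case/andP=> /allP ltc /IH ->; rewrite andbT; apply/negP => /ltc.
by rewrite /row_order !ltnn andbF.
Qed.

Hypothesis bpdP : is_bpd P.

Lemma heights_bound : all (fun r => r.+1 < n) (heights P (crossings_below P n)).
Proof.
apply/allP => r /mapP[c]; rewrite mem_crossings_below //.
case/and3P=> _ lti /andP[ltj /eqP tileX] ->.
have [_ _ e] := crossing_heights bpdP lti ltj tileX.
by have := height_minl bpdP lti ltj; rewrite e; lia.
Qed.

Lemma card_pipes_cross (p q : 'I_n) :
  #|[pred c | pipes_cross_at P p q c]| =
  count (crosses p q) (wire_pairs (@straight n) (fun k => insub k)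
                         (heights P (crossings_below P n))).
Proof.
rewrite wire_pairs_below // count_map.
set s := [seq (val c.1, val c.2)
         | c : 'I_n * 'I_n <- enum {: 'I_n * 'I_n} & P c.1 c.2 == Crossing].
have /seq.permP <- : perm_eq s (crossings_below P n).
  apply: uniq_perm; last 1 first.
  - move=> c; rewrite mem_crossings_below // subnn /=.
    apply/mapP/and3P => [[d]|[lti ltj]].
      rewrite mem_filter => /andP[tileX _] ->.
      by rewrite /= !ltn_ord tile_at_ord.
    case: c lti ltj => _ _ /= /ord_cases[a ->] /ord_cases[b ->].
    rewrite tile_at_ord => tileX.
    by exists (a, b); rewrite // mem_filter mem_enum inE /= tileX.
  - rewrite map_inj_uniq ?filter_uniq -?enumT ?enum_uniq //.
    by move=> [a b] [a' b'] /= [/val_inj -> /val_inj ->].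
  - exact: uniq_crossings_below.
rewrite count_map count_filter card_count.
by apply: eq_count => -[a b]; rewrite /= /pipes_cross_at /crosses andbC.
Qed.

End Crossings.

Section ColumnWord.
Variables (n : nat) (P : 'M[tile]_n).
Hypothesis heckeP : hecke P.

Let bpdP : is_bpd P. Proof. by case: heckeP => la []. Qed.

Let t c := entry (Omega P) c.

(** The blank paired with a crossing: a crossing with height R belongs to the entry R + 1, which is
    also the distance along the diagonal. *)
Definition crossing_cell (c : nat * nat) : nat * nat :=
  let r := (height P c.1 c.2).+1 in (c.1 - r, c.2 - r).

(** With [r] one more than the height at [c], the duality holds for [r] and fails for [r.+1],
    because the crossing raises the height to [r.+1]. *)
Lemma crossing_cellP (c : nat * nat) : c \in crossings_below P n ->
  [/\ crossing_cell c \in blanks P,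
      t (crossing_cell c) = (height P c.1 c.2).+1
    & c = ((crossing_cell c).1 + t (crossing_cell c),
           (crossing_cell c).2 + t (crossing_cell c))].
Proof.
rewrite mem_crossings_below // => /and3P[_ lti /andP[ltj /eqP tileX]].
case: c lti ltj tileX => i j /= lti ltj tileX.
rewrite /crossing_cell /=; set r := (height P i j).+1.
have [_ _ e] := crossing_heights bpdP lti ltj tileX.
have lei := height_minl bpdP lti ltj; have lej := height_minr bpdP lti ltj.
have eqi : i - r + r = i by lia.
have eqj : j - r + r = j by lia.
have tE : t (i - r, j - r) = r.
  have := leq_entry_Omega heckeP (a := i - r) (b := j - r) (u := r).
  have := leq_entry_Omega heckeP (a := i - r) (b := j - r) (u := r.+1).
  have -> : i - r + r.+1 = i.+1 by lia.
  have -> : j - r + r.+1 = j.+1 by lia.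
  by rewrite eqi eqj e -/(t _); lia.
rewrite tE eqi eqj; split=> //; apply/negPn/negP => /entry_Omega_nblank.
by rewrite -/(t _) tE.
Qed.

Lemma crossing_cell_blank (c : nat * nat) : c \in blanks P ->
  (c.1 + t c, c.2 + t c) \in crossings_below P n /\
  crossing_cell (c.1 + t c, c.2 + t c) = c.
Proof.
case: c => a b abP; have [] := entry_Omega_blank heckeP abP.
rewrite -/(t _) => t_gt0 lta ltb tileX [htt _].
rewrite mem_crossings_below // subnn /= lta ltb tileX eqxx; split=> //.
by rewrite /crossing_cell /= htt prednK // !addnK.
Qed.

Let s1 := sort column_order (enum_fset (domf (Omega P))).
Let s2 := [seq crossing_cell c | c <- crossings_below P n].

Lemma perm_crossing_cells : perm_eq s1 s2.
Proof.
apply: uniq_perm.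
- by rewrite sort_uniq fset_uniq.
- rewrite map_inj_in_uniq ?uniq_crossings_below // => c d.
  move=> /crossing_cellP[_ _ {2}->] /crossing_cellP[_ _ {2}->].
  by move=> ->.
- move=> c; rewrite mem_sort; apply/idP/mapP => [cP|]; last first.
    by case=> d /crossing_cellP[dP _ _] ->.
  have [mem eqc] := crossing_cell_blank cP.
  by exists (c.1 + t c, c.2 + t c).
Qed.

Lemma map_entry_crossing_cells :
  [seq t c | c <- s2] = map S (heights P (crossings_below P n)).
Proof.
rewrite /heights -!map_comp; apply/eq_in_map => c /crossing_cellP[_ tE _].
by rewrite /= tE.
Qed.

Lemma size_column_word :
  size (column_word (Omega P)) = size (heights P (crossings_below P n)).
Proof.
by rewrite size_map (perm_size perm_crossing_cells) !size_map.
Qed.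

Lemma entry_Omega_decrease (a b a' b' : nat) : a <= a' -> b <= b' ->
  t (a', b') <= t (a, b) - (a' - a) - (b' - b).
Proof.
case: (heckeP) => la shape lea leb.
have steps a0 b0 := tableau_steps a0 b0 (Omega_decreasing heckeP shape).
have := @entry_decrease (fun a0 b0 => t (a0, b0)) _ _ a b (a' - a) (b' - b).
rewrite !subnKC //; apply=> a0 b0; by have [] := steps a0 b0.
Qed.

(* Two letters that differ by one are read in the same order in the column
   word and along the crossings. *)
Lemma crossing_order_commute (c d : nat * nat) :
  c \in blanks P -> d \in blanks P -> column_order c d ->
  row_order (d.1 + t d, d.2 + t d) (c.1 + t c, c.2 + t c) ->
  commute (simple_transposition n (t c)) (simple_transposition n (t d)).
Proof.
case: c d => [a b] [a' b'] abP a'b'P.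
have [t_gt0 _ _ _ _] := entry_Omega_blank heckeP abP.
have [t'_gt0 _ _ _ _] := entry_Omega_blank heckeP a'b'P.
have := @entry_Omega_decrease a b a' b'.
rewrite /column_order /row_order /= -!/(t _) in t_gt0 t'_gt0 *.
move=> dec col row.
(* If the entry of [c] is smaller, then [d] lies in a higher row and, not being to the left of [c],
   can have its crossing read first only if the entries differ by at least 2. If it is larger, then
   [d] lies strictly below and strictly to the right of [c], so the entry drops by at least 2. *)
have [lt|lt|->//] := ltngtP (t (a, b)) (t (a', b')).
  by apply: simple_transposition_commute => //; lia.
by apply/commute_sym/simple_transposition_commute => //; lia.
Qed.

Lemma word_perm_column_word :
  word_perm n (column_word (Omega P)) =
  word_perm n (map S (heights P (crossings_below P n))).
Proof.
transitivity (\prod_(c <- rev s2) simple_transposition n (t c))%g; last first.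
  by rewrite -map_entry_crossing_cells /word_perm -map_rev big_map.
rewrite /word_perm /column_word -map_rev big_map.
apply: (@big_commuting_reorder _ _ (fun c => simple_transposition n (t c))
  column_order
  (fun c d => row_order (c.1 + t c, c.2 + t c) (d.1 + t d, d.2 + t d))
  s1 s2).
- rewrite -sorted_pairwise; last first.
    by move=> c d e; rewrite /column_order; lia.
  by apply: sort_sorted => c d; rewrite /column_order; lia.
- rewrite pairwise_map.
  apply: (sub_in_pairwise (P := mem (crossings_below P n)) _ _
            (pairwise_crossings_below P (leqnn n))); last by apply/allP.
  by move=> c d /crossing_cellP[_ _ {1}->] /crossing_cellP[_ _ {1}->].
- exact: perm_crossing_cells.
- move=> c d; rewrite !mem_sort => cP dP; exact: crossing_order_commute.
Qed.

End ColumnWord.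

(** * Reduced BPDs, reduced words and the Demazure product *)

Section Reduced.
Variables (n : nat) (P : 'M[tile]_n).
Hypothesis heckeP : hecke P.

Let bpdP : is_bpd P. Proof. by case: heckeP => la []. Qed.

Lemma bpd_reduced_crosses : bpd_reduced P <->
  (forall x y : 'I_n, x < y -> count (crosses x y)
    (wire_pairs (@straight n) (fun k => insub k)
       (heights P (crossings_below P n))) <= 1).
Proof.
split=> [red x y ltxy|once x y].
  by rewrite -card_pipes_cross // red // neq_ltn ltxy.
rewrite neq_ltn => /orP[ltxy|ltyx]; first by rewrite card_pipes_cross // once.
rewrite -(eq_card (A := [pred c | pipes_cross_at P y x c])) => [|c].
  by rewrite card_pipes_cross // once.
by rewrite !inE /pipes_cross_at orbC.
Qed.

Lemma bpd_reduced_column_word : bpd_reduced P <->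
  size (column_word (Omega P)) =
    inversions (word_perm n (column_word (Omega P))).
Proof.
rewrite size_column_word // word_perm_column_word // bpd_reduced_crosses.
have := reduced_word_crosses (heights_bound bpdP) => redE.
split=> [once|/eqP].
  by apply/eqP; rewrite redE; apply/forall_inP => -[x y] /=; apply: once.
by rewrite redE => /forall_inP once x y; apply: (once (x, y)).
Qed.

(** The run starts at the identity, which has no inversions, so reducedness is exactly the condition
    under which the Demazure rule runs straight. *)
Lemma demazure_product_reduced (i : 'I_n) : bpd_reduced P ->
  demazure_product P i = Some (word_perm n (column_word (Omega P)) i).
Proof.
move=> /bpd_reduced_crosses once.
rewrite /demazure_product label_right_boundary // /state_below -perm_labels1.
rewrite demazure_run ?heights_bound // => [|x y ltxy]; last first.
  rewrite perm_labels1 /value_inversion invg1 !perm1 [y < x]ltnNge (ltnW ltxy).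
  by rewrite andbF add0n once.
rewrite straight_run ?heights_bound // mulg1 -word_perm_column_word //.
exact: perm_labels_ord.
Qed.

Lemma entry_Omega_range (c : nat * nat) : c \in domf (Omega P) ->
  0 < entry (Omega P) c < n.
Proof.
case: c => a b /(entry_Omega_blank heckeP)[-> lta _ _ _] /=.
exact: leq_ltn_trans (leq_addl _ _) lta.
Qed.

Lemma column_word_range :
  all (fun k => 0 < k < n) (column_word (Omega P)).
Proof.
apply/allP => k /mapP[c]; rewrite mem_sort => cP ->.
exact: entry_Omega_range.
Qed.

End Reduced.

Theorem corollary8p5 (n : nat) (hn : 1 <= n) :
  [/\ set_bij (@edelman_greene n) (RWT n.-1) (@Omega n),
      forall (la : seq nat) (P : 'M[tile]_n), edelman_greene P ->
        (hecke_of_shape la P <-> decreasing_tableau la (Omega P))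
    & forall (w : 'S_n) (P : 'M[tile]_n), edelman_greene P ->
        (Pipes w P <-> reduced_word w (column_word (Omega P)))].
Proof.
split.
(* [RWT m] speaks of permutations in ['S_m.+1], hence the form [m.+1] for the size. *)
- case: n hn => // m _; split.
  + move=> P [heckeP redP]; have [la shape] := heckeP; split.
    * by exists la; apply: Omega_decreasing.
    * move=> c /(entry_Omega_range heckeP) /=.
      by rewrite ltnS.
    * exists (word_perm m.+1 (column_word (Omega P))); split=> //.
        exact: column_word_range.
      exact/bpd_reduced_column_word.
  + move=> P Q /set_mem[heckeP _] /set_mem[heckeQ _]; exact: Omega_inj.
  + move=> T [[la decT] T_range [w [_ wE sizeE]]].
    have [c cT|P heckeP eqT] := @Omega_surj m.+1 la T decT.
      by have /andP[] := T_range c cT.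
    exists P => //; split=> //; apply/bpd_reduced_column_word => //.
    by rewrite eqT sizeE wE.
- move=> la P [heckeP _]; split=> [|[la_part domE _ _ _]].
    exact: Omega_decreasing.
  by have [? [bpdP _ _]] := heckeP; split.
- move=> w P [heckeP redP]; split=> [[_ PipesE]|[_ -> _]].
    have wE : w = word_perm n (column_word (Omega P)).
      apply/permP => i; have := PipesE i.
      by rewrite demazure_product_reduced // => -[].
    split=> //; first exact: column_word_range.
    by rewrite wE; apply/bpd_reduced_column_word.
  split; first by have [? []] := heckeP.
  by move=> i; apply: demazure_product_reduced.
Qed.
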